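(* Let $n\ge 1$ be an integer, let $H$ be a finite group, and let $G=\mathbb{Z}_n\times H$. Then for any complex numbers $a_{ih}$ ($0\le i\le n-1$, $h\in H$), $$\mathcal{D}_G\left(\sum_{i=0}^{n-1}\sum_{h\in H} a_{ih}\,(i,h)\right)=\prod_{y\in\mathbb{C},\ y^n=1}\mathcal{D}_H\left(\sum_{h\in H}\left(\sum_{i=0}^{n-1}a_{ih}y^i\right)h\right).$$
   Context: $\mathbb{Z}_n$ denotes the cyclic group of order $n$, written additively with elements $0,1,\dots,n-1$, so elements of $G=\mathbb{Z}_n\times H$ are pairs $(i,h)$. For a finite group $K$ and an element $\sum_{g\in K}a_g g$ of the group ring $\mathbb{C}[K]$, the group determinant is $\mathcal{D}_K\left(\sum_{g\in K}a_g g\right)=\det\left(a_{gh^{-1}}\right)_{g,h\in K}$, the determinant of the $|K|\times|K|$ matrix whose rows and columns are indexed by the elements of $K$ in the same order and whose $(g,h)$ entry is $a_{gh^{-1}}$. The product on the right is over the $n$ complex $n$th roots of unity $y$. $H$ is not assumed to be abelian. *)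

(* Defs.v *)
From mathcomp Require Export all_boot all_order all_fingroup all_algebra.
From mathcomp Require Export complex.
From mathcomp Require Export boolp classical_sets fsbigop reals.

Set Implicit Arguments.
Unset Strict Implicit.
Unset Printing Implicit Defensive.

Local Open Scope ring_scope.

(* An element sum_g a_g g of the group ring C[K] is its coefficient function
   in {ffun K -> C^o}; C^o makes this type a C-module, so that formal sums can
   be written with *: and \sum.  The ring product of C[K] is not needed. *)
Definition grp_elt (C : comNzRingType) (K : finGroupType) (g : K) :
    {ffun K -> C^o} := [ffun k => (k == g)%:R].

Definition group_det (C : comNzRingType) (K : finGroupType)
    (a : {ffun K -> C^o}) : C :=
  \det (\matrix_(i < #|K|, j < #|K|) a (enum_val i * (enum_val j)^-1)%g).

(* Main.v *)
Require Import Defs.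
From mathcomp Require Import separable cyclotomic.

(* List the n-th roots of unity as y_l, and let M be the matrix of the group
   determinant of Z_n x H, B_l that of the factor attached to y_l.  With
   W_((l,h),(i,k)) = [h = k] y_l^i one has W M = diag(B_l) W, the row of index l
   picking out the character i |-> y_l^i of Z_n.  W is a Vandermonde matrix
   tensored with the identity, so it is invertible and det M = prod_l det B_l. *)

Set Implicit Arguments.
Unset Strict Implicit.
Unset Printing Implicit Defensive.

Import GRing.Theory.

Local Open Scope complex_scope.
Local Open Scope classical_set_scope.
Local Open Scope ring_scope.

(** Indexing by an arbitrary finite type allows rows labelled by pairs or by a disjoint union
    without fixing a numbering; [group_det] is an instance by conversion. *)
Definition fin_det (C : comNzRingType) (T : finType) (A : T -> T -> C) : C :=
  \det (\matrix_(i < #|T|, j < #|T|) A (enum_val i) (enum_val j)).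

Lemma eq_fin_det (C : comNzRingType) (T : finType) (A B : T -> T -> C) :
  A =2 B -> fin_det A = fin_det B.
Proof. by move=> eqAB; congr (\det _); apply/matrixP=> i j; rewrite !mxE. Qed.

(** Two numberings of [T] differ by a permutation [s], so the matrices are conjugate under the
    permutation matrix of [s], and the determinants of that matrix and its inverse cancel. *)
Lemma fin_detE (C : comNzRingType) (T : finType) (A : T -> T -> C) (m : nat)
    (f : 'I_m -> T) :
  bijective f -> \det (\matrix_(i, j) A (f i) (f j)) = fin_det A.
Proof.
move=> bij_f; have Em : m = #|T| by rewrite -(bij_eq_card bij_f) card_ord.
(* [enum_val] is generalized to any bijection [e], so that [#|T|] can be replaced by [m] despite the
   dependent type. *)
rewrite /fin_det; move: (@enum_val T T) (@enum_val_bij T) => e.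
case: _ / Em e => e bij_e.
have [g eK Ke] := bij_e.
have inj_s : injective (g \o f).
  by apply: inj_comp; [apply: can_inj Ke | apply: bij_inj].
pose s := perm inj_s.
have -> : \matrix_(i, j) A (f i) (f j)
    = row_perm s (col_perm s (\matrix_(i, j) A (e i) (e j))).
  by apply/matrixP=> i j; rewrite !mxE !permE /= !Ke.
rewrite row_permE col_permE !det_mulmx mulrCA -det_mulmx -perm_mxM.
by rewrite mulgV perm_mx1 det1 mulr1.
Qed.

Lemma fin_det_reindex (C : comNzRingType) (S T : finType) (A : T -> T -> C)
    (f : S -> T) :
  bijective f -> fin_det (fun x y => A (f x) (f y)) = fin_det A.
Proof.
by move=> bij_f; apply: (@fin_detE _ _ A _ (f \o enum_val));
   apply: bij_comp bij_f (enum_val_bij _).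
Qed.

Lemma fin_detM (C : comNzRingType) (T : finType) (A B : T -> T -> C) :
  fin_det (fun x y => \sum_z A x z * B z y) = fin_det A * fin_det B.
Proof.
rewrite /fin_det -det_mulmx; congr (\det _); apply/matrixP=> i j; rewrite !mxE.
rewrite (reindex (@enum_val T T)) /=; last exact: onW_bij (enum_val_bij T).
by apply: eq_bigr=> k _; rewrite !mxE.
Qed.

Lemma fin_det_scalar (C : comNzRingType) (T : finType) (c : C) :
  fin_det (fun x y : T => c *+ (x == y)) = c ^+ #|T|.
Proof.
rewrite -det_scalar; congr (\det _); apply/matrixP=> i j.
by rewrite !mxE (inj_eq enum_val_inj).
Qed.

(** Numbering [S] first and then [T] makes the matrix block diagonal. *)
Lemma fin_det_sum (C : comNzRingType) (S T : finType) (A : S -> S -> C)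
    (B : T -> T -> C) :
  fin_det (fun x y : S + T => match x, y with
                              | inl s, inl s' => A s s'
                              | inr t, inr t' => B t t'
                              | _, _ => 0
                              end)
  = fin_det A * fin_det B.
Proof.
pose f (i : 'I_(#|S| + #|T|)) : (S + T)%type := match split i with
  | inl j => inl (enum_val j) | inr j => inr (enum_val j) end.
have bij_f : bijective f.
  exists (fun x => unsplit (match x with inl s => inl (enum_rank s)
                                       | inr t => inr (enum_rank t) end)).
    move=> i; rewrite -[RHS]splitK /f.
    by case: (split i) => j; rewrite enum_valK.
  by case=> x; rewrite /f unsplitK enum_rankK.
rewrite -(fin_detE _ bij_f) /fin_det -(det_ublock _ 0).
congr (\det _); apply/matrixP=> i j; rewrite !mxE /f.
by case: (split i) => i'; rewrite !mxE; case: (split j) => j'; rewrite !mxE.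
Qed.

(** Induction on [n]: the block of index 0 is split off through the bijection of [T + 'I_n * T] with
    ['I_n.+1 * T]. *)
Lemma fin_det_blocks (C : comNzRingType) (n : nat) (T : finType)
    (B : 'I_n -> T -> T -> C) :
  fin_det (fun x y : 'I_n * T => B x.1 x.2 y.2 *+ (x.1 == y.1))
  = \prod_(l < n) fin_det (B l).
Proof.
elim: n B => [|n IHn] B.
  rewrite big_ord0 /fin_det; set M := (\matrix_(_, _) _).
  by move: M; rewrite card_prod card_ord mul0n => M; rewrite det_mx00.
rewrite big_ord_recl -(IHn (fun l => B (lift ord0 l))) -fin_det_sum.
pose f (x : T + 'I_n * T) : 'I_n.+1 * T :=
  match x with inl t => (ord0, t) | inr p => (lift ord0 p.1, p.2) end.
have bij_f : bijective f.
  exists (fun p => if unlift ord0 p.1 is Some i then inr (i, p.2) else inl p.2).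
    by case=> [t|[i t]] /=; rewrite ?unlift_none ?liftK.
  by case=> i t /=; case: unliftP => [j|] ->.
rewrite -(fin_det_reindex _ bij_f); apply: eq_fin_det.
by case=> [t|[i t]] [t'|[i' t']] //=; rewrite ?(inj_eq lift_inj).
Qed.

Lemma group_detE (C : comNzRingType) (K : finGroupType) (a : {ffun K -> C^o}) :
  group_det a = fin_det (fun g h => a (g * h^-1)%g).
Proof. by []. Qed.

Lemma sum_grp_eltE (C : comNzRingType) (K : finGroupType) (c : K -> C) (k : K) :
  (\sum_g c g *: @grp_elt C K g) k = c k.
Proof.
rewrite sum_ffunE (bigD1 k) //= big1 => [|g /negbTE neq_gk]; rewrite !ffunE.
  by rewrite eqxx addr0 [_ *: _]mulr1.
by rewrite eq_sym neq_gk scaler0.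
Qed.

Lemma Vandermonde_det_neq0 (C : idomainType) (n : nat) (y : 'I_n -> C) :
  injective y -> \det (\matrix_(l, i < n) y l ^+ i) != 0.
Proof.
move=> inj_y; have -> : \matrix_(l, i < n) y l ^+ i = (Vandermonde n (\row_l y l))^T.
  by apply/matrixP=> i j; rewrite !mxE.
rewrite det_tr det_Vandermonde; apply/prodf_neq0=> i _; apply/prodf_neq0=> j ltij.
rewrite !mxE subr_eq0 (inj_eq inj_y); apply: contraTneq ltij => ->.
by rewrite ltnn.
Qed.

(** The product of V ⊗ 1 and adj V ⊗ 1 is the scalar matrix of det V, whose determinant is a power
    of det V. Hence the determinant of V ⊗ 1 need not be computed. *)
Lemma fin_det_tens1_neq0 (C : idomainType) (n : nat) (T : finType)
    (V : 'M[C]_n) :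
  \det V != 0 ->
  fin_det (fun x y : 'I_n * T => V x.1 y.1 *+ (x.2 == y.2)) != 0.
Proof.
move=> V_neq0; set W := fin_det _.
suff : W * fin_det (fun x y : 'I_n * T => (\adj V) x.1 y.1 *+ (x.2 == y.2)) != 0.
  by rewrite mulf_eq0 negb_or => /andP[].
rewrite -fin_detM.
rewrite (@eq_fin_det _ _ _ (fun x y => \det V *+ (x == y))).
  by rewrite fin_det_scalar expf_neq0.
move=> [i t] [j u]; rewrite /= xpair_eqE -mulnb mulrnA.
have /matrixP/(_ i j) := mul_mx_adj V; rewrite !mxE => <-.
rewrite -sumrMnl -(pair_bigA _ (fun k v =>
  V i k *+ (t == v) * (\adj V k j *+ (v == u)))) /=.
apply: eq_bigr => k _; rewrite (bigD1 t) //= eqxx mulrnAr big1 ?addr0 // => v.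
by rewrite eq_sym => /negbTE->; rewrite mul0r.
Qed.

Lemma group_det_cyclic_prod (C : idomainType) (n : nat) (H : finGroupType)
    (a : 'I_n.+1 -> H -> C) (y : 'I_n.+1 -> C) :
  injective y -> (forall l, y l ^+ n.+1 = 1) ->
  group_det (\sum_(i < n.+1) \sum_(h : H)
               a i h *: @grp_elt C ('I_n.+1 * H)%type (i, h))
  = \prod_(l < n.+1)
      group_det (\sum_(h : H)
                   (\sum_(i < n.+1) a i h * y l ^+ i) *: @grp_elt C H h).
Proof.
move=> inj_y y_root.
have := fin_det_tens1_neq0 H (Vandermonde_det_neq0 inj_y).
set V := (\matrix_(l, i) _) => V_neq0.
(* After multiplication by the nonzero det W, the claim follows from W M = diag(B_l) W, checked
   entrywise at row (l, h) and column (j, k). *)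
apply: (mulfI V_neq0); rewrite group_detE (eq_bigr _ (fun l _ => group_detE _)).
rewrite -fin_det_blocks [RHS]mulrC -!fin_detM; apply: eq_fin_det.
move=> [l h] [j k].
set b := (\sum_i \sum_h _).
pose c l := \sum_h (\sum_i a i h * y l ^+ i) *: @grp_elt C H h.
rewrite -[LHS](pair_bigA _ (fun (i : 'I_n.+1) (v : H) =>
  V l i *+ (h == v) * b ((i, v) * (j, k)^-1)%g)) /=.
rewrite -[RHS](pair_bigA _ (fun (i : 'I_n.+1) (v : H) =>
  c l (h * v^-1)%g *+ (l == i) * (V i j *+ (v == k)))) /=.
(* In W M only the terms with v = h survive, and (i, h) (j, k)^-1 = (i - j, h k^-1), with i - j
   taken modulo [n.+1]. *)
transitivity (\sum_(i < n.+1) y l ^+ i * a (i - j)%R (h * k^-1)%g).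
  apply: eq_bigr => i _; rewrite (bigD1 h) //= big1 ?addr0 => [|v].
    rewrite /b pair_bigA eqxx mxE mulr1n; congr (_ * _).
    under eq_bigr => g _ do rewrite -surjective_pairing.
    by rewrite (sum_grp_eltE (fun g : 'I_n.+1 * H => a g.1 g.2)).
  by rewrite eq_sym => /negbTE->; rewrite mul0r.
(* In diag(B_l) W only the term with i = l and v = k survives. *)
rewrite [RHS](bigD1 l) //= [X in _ + X]big1 ?addr0; last first.
  move=> i; rewrite eq_sym => /negbTE->.
  by apply: big1 => v _; rewrite mul0r.
rewrite [RHS](bigD1 k) //= [X in _ + X]big1 ?addr0; last first.
  by move=> v /negbTE->; rewrite mulr0.
rewrite !eqxx !mulr1n sum_grp_eltE mxE mulr_suml.
(* The shift of i by j is modulo [n.+1]; since y_l is a root of unity, i |-> y_l^i is a character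
   and the factor y_l^j comes out. *)
rewrite (reindex_inj (addIr j)); apply: eq_bigr => i _ /=.
by rewrite addrK (expr_mod _ (y_root l)) exprD mulrC mulrA.
Qed.

(** X^n - 1 splits over [F], and it is separable because n is nonzero in [F]; its list of roots thus
    has n distinct entries. *)
Lemma unity_roots_enum (F : closedFieldType) (n : nat) :
  n%:R != 0 :> F ->
  {y : n.-tuple F | uniq y & forall z, (z \in y) = (z ^+ n == 1)}.
Proof.
move=> n_neq0; have n_gt0 : (0 < n)%N by case: n n_neq0 => //; rewrite eqxx.
have [r Dr] := closed_field_poly_normal ('X^n - 1 : {poly F}).
rewrite (monicP _) ?monicXnsubC // scale1r in Dr.
have size_r : size r == n.
  by rewrite -eqSS -(size_prod_XsubC r id) -Dr size_XnsubC.
exists (Tuple size_r) => [|z] /=.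
  by rewrite -separable_prod_XsubC -Dr separable_Xn_sub_1.
by rewrite -root_prod_XsubC -Dr rootE !hornerE subr_eq0.
Qed.

Theorem theorem2p1 (R : realType) (n : nat) (H : finGroupType)
    (a : 'I_n.+1 -> H -> R[i]) :
  group_det (\sum_(i < n.+1) \sum_(h : H)
               a i h *: @grp_elt R[i] ('I_n.+1 * H)%type (i, h))
  = \big[*%R/1]_(y \in [set y : R[i] | y ^+ n.+1 = 1])
      group_det (\sum_(h : H)
                   (\sum_(i < n.+1) a i h * y ^+ i) *: @grp_elt R[i] H h).
Proof.
have n_neq0 : n.+1%:R != 0 :> R[i] by rewrite Num.Theory.pnatr_eq0.
have [y uniq_y yP] := unity_roots_enum n_neq0.
have -> : [set z : R[i] | z ^+ n.+1 = 1] = [set` val y].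
  by apply/seteqP; split=> z /=; [move=> z1; rewrite yP z1 | rewrite yP => /eqP].
rewrite -(fsbig_seq _ _ uniq_y) big_tuple (@group_det_cyclic_prod _ _ _ _ (tnth y)) //.
  exact/tuple_uniqP.
by move=> l; apply/eqP; rewrite -yP mem_tnth.
Qed.
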